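(* Let $N\ge1$, $h,l>0$, $\theta_1,\theta_2,\theta_3>0$, $(\alpha,\beta)\in\mathbb R^2\setminus\{(0,0)\}$, and let $T=T_N$ be the transmission probability of the $N$-resonator system described in the context, with type-I vertex conditions. Put $$A=\frac{\theta_1^2+\theta_2^2}{2\theta_1\theta_2},\qquad B=\frac{\theta_3^2}{2\theta_1\theta_2},$$ $\psi(k)=kh$, and let $\phi(k)$ be the resonator phase defined in the context. Define $$\mathcal F(\phi,\psi)=\frac{\cos^2\phi}{\cos^2\phi+\bigl[(A^2-1)\cos^2\phi+B^2\sin^2\phi\bigr]\,U_{N-1}^2\bigl(A\cos\psi-B\tan\phi\sin\psi\bigr)}$$ for $(\phi,\psi)\in\mathbb R^2$ with $\cos\phi\neq0$. Then: (a) The function $\mathcal F$ is $\pi$-periodic in each argument, takes values in $[0,1]$, and is smooth on $\{(\phi,\psi):\phi\ne\pi n-\tfrac\pi2,\ n\in\mathbb Z\}$. (b) Setting $\mathcal F(\pi n-\tfrac\pi2,\psi)=0$ for all $n\in\mathbb Z$ and all $\psi$ with $\sin\psi\ne0$ extends $\mathcal F$ continuously to those lines away from the lattice points, i.e. the extended function is continuous on $\mathbb R^2\setminus\Lambda$, where $\Lambda=(\pi\mathbb Z-\tfrac\pi2)\times\pi\mathbb Z$. (c) $T(k)=\mathcal F\bigl(\phi(k),\psi(k)\bigr)$ for every $k>0$ with $(\phi(k),\psi(k))\notin\Lambda$.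
   Context: Model. The metric graph $G$ has vertices $v_1,\dots,v_N$ of degree 3, placed on the real line (the channel) at $x_j=(j-1)h$, and vertices $u_1,\dots,u_N$ of degree 1. The channel consists of the leads $e_{in}=(-\infty,0]$ (ending at $v_1$), $e_{out}=[(N-1)h,+\infty)$ (starting at $v_N$), and the segments of length $h$ between consecutive $v_j$'s. At each $v_j$ a resonator edge $(v_j,u_j)$ of length $l$ is attached, with coordinate $s\in[0,l]$, $s=0$ at $v_j$ and $s=l$ at $u_j$. For a function $f$ on $G$ and $v=v_j$, $f_1(v),f_2(v),f_3(v)$ denote the limits of $f$ at $v$ along the left channel edge, the right channel edge and the resonator edge, and $f_i'(v)$ the corresponding one-sided derivatives taken in the direction from $v$ into the edge. Type-I vertex conditions at every $v_j$: $\frac{f_1(v)}{\theta_1}=\frac{f_2(v)}{\theta_2}=\frac{f_3(v)}{\theta_3}$ and $\theta_1f_1'(v)+\theta_2f_2'(v)+\theta_3f_3'(v)=0$. Endpoint condition at each $u_j$: $\alpha f+\beta\frac{df}{ds}=0$ at $s=l$. Scattering solution at wavenumber $k>0$: a function $f$ on $G$ with $f''+k^2f=0$ on every edge, satisfying all vertex and endpoint conditions, with $f(x)=e^{ikx}+r_N(k)e^{-ikx}$ on $e_{in}$ and $f(x)=t_N(k)e^{ikx}$ on $e_{out}$. The amplitudes are uniquely determined; $T_N(k)=|t_N(k)|^2$. Resonator phase: $\phi(k)=kl-\delta(k)$, where $\delta\equiv0$ if $\alpha=0$ (Neumann), $\delta\equiv\pi/2$ if $\beta=0$ (Dirichlet),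 and $\delta(k)=\arctan\frac{\alpha}{\beta k}$ if $\alpha\beta\ne0$ (Robin). $U_n$ are the Chebyshev polynomials of the second kind: $U_0(\xi)=1$, $U_1(\xi)=2\xi$, $U_{n+2}(\xi)=2\xi U_{n+1}(\xi)-U_n(\xi)$. *)

(* Defs.v *)
From Stdlib Require Import Reals ZArith.
From Coquelicot Require Import Coquelicot.
Open Scope R_scope.

(** * Functions on the metric graph

    Vertices are numbered [1 .. N] as in [v_1, ..., v_N].  The channel edges are
    numbered [0 .. N]: edge [0] is the incoming lead, edge [N] is the outgoing
    lead, and edge [j] (for [1 <= j < N]) is the segment from [v_j] to
    [v_(j+1)].  Thus [v_j] has left channel edge [j - 1] and right channel edge
    [j].

    Since the vertex conditions allow a jump at [v_j], a function on the graph
    is given edge by edge, and only its values in the open edges matter. *)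

Record graph_function := {
  on_channel : nat -> R -> C;     (* coordinate x on the channel *)
  on_resonator : nat -> R -> C    (* coordinate s, measured from v_j *)
}.

Definition vertex_pos (h : R) (j : nat) : R := (INR j - 1) * h.

Definition in_channel_edge (N : nat) (h : R) (j : nat) (x : R) : Prop :=
  ((1 <= j)%nat -> vertex_pos h j < x) /\
  ((j < N)%nat -> x < vertex_pos h (S j)).

Definition helmholtz_on (k : R) (D : R -> Prop) (f : R -> C) : Prop :=
  exists f' f'' : R -> C,
    forall x, D x ->
      @is_derive R_AbsRing C_R_NormedModule f x (f' x) /\
      @is_derive R_AbsRing C_R_NormedModule f' x (f'' x) /\
      (f'' x + RtoC (k ^ 2) * f x)%C = RtoC 0.

(** [edge_trace g a d]: [g] is a function on an edge, written in the arc length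
    coordinate measured from one end into the edge; [a] is its limit at that end
    and [d] its one-sided derivative there, in the direction into the edge.
    The value [g 0] is not used. *)
Definition edge_trace (g : R -> C) (a d : C) : Prop :=
  filterlim g (at_right 0) (@locally C_UniformSpace a) /\
  filterlim (fun s => ((g s - a) / RtoC s)%C) (at_right 0)
            (@locally C_UniformSpace d).

Definition type_I_condition (h th1 th2 th3 : R) (f : graph_function) (j : nat)
  : Prop :=
  exists f1 f2 f3 d1 d2 d3 : C,
    edge_trace (fun s => on_channel f (pred j) (vertex_pos h j - s)) f1 d1 /\
    edge_trace (fun s => on_channel f j (vertex_pos h j + s)) f2 d2 /\
    edge_trace (fun s => on_resonator f j s) f3 d3 /\
    (f1 / RtoC th1)%C = (f2 / RtoC th2)%C /\
    (f2 / RtoC th2)%C = (f3 / RtoC th3)%C /\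
    (RtoC th1 * d1 + RtoC th2 * d2 + RtoC th3 * d3)%C = RtoC 0.

(** [d] is [df/ds] at [s = l]; the derivative into the edge is [- d]. *)
Definition endpoint_condition (l al be : R) (f : graph_function) (j : nat)
  : Prop :=
  exists a d : C,
    edge_trace (fun s => on_resonator f j (l - s)) a (- d)%C /\
    (RtoC al * a + RtoC be * d)%C = RtoC 0.

(** [expi x] is the complex exponential of [i x]. *)
Definition expi (x : R) : C := (cos x, sin x).

Definition scattering_solution (N : nat) (h l th1 th2 th3 al be k : R)
    (r t : C) (f : graph_function) : Prop :=
  (forall j, (j <= N)%nat ->
     helmholtz_on k (in_channel_edge N h j) (on_channel f j)) /\
  (forall j, (1 <= j <= N)%nat ->
     helmholtz_on k (fun s => 0 < s < l) (on_resonator f j)) /\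
  (forall j, (1 <= j <= N)%nat -> type_I_condition h th1 th2 th3 f j) /\
  (forall j, (1 <= j <= N)%nat -> endpoint_condition l al be f j) /\
  (forall x, in_channel_edge N h 0 x ->
     on_channel f 0 x = (expi (k * x) + r * expi (- (k * x)))%C) /\
  (forall x, in_channel_edge N h N x ->
     on_channel f N x = (t * expi (k * x))%C).

(** [T] is the squared modulus of the transmission amplitude, the pair of
    amplitudes [(r, t)] being uniquely determined. *)
Definition is_transmission_probability (N : nat)
    (h l th1 th2 th3 al be k T : R) : Prop :=
  exists r t : C,
    (exists f, scattering_solution N h l th1 th2 th3 al be k r t f) /\
    (forall r' t' f',
       scattering_solution N h l th1 th2 th3 al be k r' t' f' ->
       r' = r /\ t' = t) /\
    T = Cmod t ^ 2.

(** * The transmission profile *)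

Definition resonator_delta (al be k : R) : R :=
  if Req_EM_T al 0 then 0
  else if Req_EM_T be 0 then PI / 2
  else atan (al / (be * k)).

Definition resonator_phase (l al be k : R) : R :=
  k * l - resonator_delta al be k.

Fixpoint chebyshev_U (n : nat) (xi : R) : R :=
  match n with
  | O => 1
  | S O => 2 * xi
  | S (S m as n') => 2 * xi * chebyshev_U n' xi - chebyshev_U m xi
  end.

Definition coef_A (th1 th2 : R) : R := (th1 ^ 2 + th2 ^ 2) / (2 * th1 * th2).
Definition coef_B (th1 th2 th3 : R) : R := th3 ^ 2 / (2 * th1 * th2).

(** Meaningful for [cos phi <> 0] only. *)
Definition profile (N : nat) (A B phi psi : R) : R :=
  cos phi ^ 2 /
  (cos phi ^ 2 +
   ((A ^ 2 - 1) * cos phi ^ 2 + B ^ 2 * sin phi ^ 2) *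
   chebyshev_U (N - 1) (A * cos psi - B * tan phi * sin psi) ^ 2).

(** The extension by zero to the lines [phi = PI * n - PI / 2], which are the
    zeros of [cos].  Its values on [lattice] are irrelevant. *)
Definition profile_ext (N : nat) (A B phi psi : R) : R :=
  if Req_EM_T (cos phi) 0 then 0 else profile N A B phi psi.

Definition lattice (phi psi : R) : Prop :=
  exists n m : Z, phi = PI * IZR n - PI / 2 /\ psi = PI * IZR m.

(* Main.v *)
Require Import Defs.
From Stdlib Require Import Reals ZArith Lra Lia Psatz.
From Coquelicot Require Import Coquelicot.
Open Scope R_scope.

(** On every edge a solution is a plane wave
    [y cos (k (x - x0)) + z sin (k (x - x0))], so that a scattering solution is
    the same thing as a finite linear system for the pairs [(y, z)] at the
    vertices ([scattering_solution_iff]).  On a resonator the endpoint condition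
    leaves one amplitude [a]; the resonator contributes the value [a cos phi] and
    the inward derivative [k a sin phi] at its vertex, and this is all the channel
    sees of it.

    If [cos phi <> 0], the amplitude can be eliminated.  With [q = th2 / th1] and
    [p = 2 B tan phi], passing one period of the chain acts on [(y, z)] by the
    rotation by [psi = k h] followed by the matrix [V] with rows [(q, 0)] and
    [(- p, 1 / q)].  The product [M = V R(psi)] is real, has determinant [1] and
    trace [2 xi], where [xi = A cos psi - B tan phi sin psi]; by Cayley-Hamilton
    the whole chain, from the left of [v_1] to the right of [v_N], acts by
    [M^N R(psi)^(-1) = U_(N-1)(xi) V - U_(N-2)(xi) R(psi)^(-1)]
    ([transfer_power]).  For a real unimodular matrix with rows [(a, b)] and
    [(c, d)] the amplitudes are unique and the transmitted intensity is
    [4 / (4 + (a - d)^2 + (b + c)^2)] ([unimodular_scattering]).  A rotation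
    contributes nothing to [a - d] and [b + c], so the term with [U_(N-2)] drops
    out, and [V] contributes [(q - 1 / q)^2 + p^2 = 4 (A^2 - 1 + B^2 tan^2 phi)]:
    this is the profile.

    If [cos phi = 0], the resonators impose a zero of the field at every vertex;
    hence [1 + r = 0] at [v_1] and [t = 0] at [v_N]
    ([scattering_system_blocked]), in agreement with the extension by zero.

    The profile lies in [[0, 1]] because [A >= 1].  It is smooth where
    [cos phi <> 0] because the rational expressions in sines and cosines with
    denominators free of zeros there are closed under differentiation
    ([trig_rational_derive]).  Near a line [cos phi = 0], and where
    [sin psi <> 0], the argument [xi] is large, hence [|U_(N-1)(xi)| >= 1], and
    the profile is at most [cot^2 phi / B^2], which tends to [0]. *)

(** * Chebyshev polynomials *)

Lemma chebyshev_U_SS (n : nat) (x : R) :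
  chebyshev_U (S (S n)) x = 2 * x * chebyshev_U (S n) x - chebyshev_U n x.
Proof. reflexivity. Qed.

Lemma chebyshev_U_opp (n : nat) (x : R) :
  chebyshev_U n (- x) = (- 1) ^ n * chebyshev_U n x.
Proof.
  enough (chebyshev_U n (- x) = (- 1) ^ n * chebyshev_U n x /\
          chebyshev_U (S n) (- x) = (- 1) ^ S n * chebyshev_U (S n) x) by tauto.
  induction n as [|n [IH1 IH2]].
  - simpl; split; ring.
  - split; [exact IH2|].
    rewrite !chebyshev_U_SS, IH1, IH2; simpl; ring.
Qed.

Lemma chebyshev_U_opp_sqr (n : nat) (x : R) :
  chebyshev_U n (- x) ^ 2 = chebyshev_U n x ^ 2.
Proof.
  rewrite chebyshev_U_opp, Rpow_mult_distr, <- pow_mult, Nat.mul_comm, pow_mult.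
  replace ((- 1) ^ 2) with 1 by ring.
  now rewrite pow1, Rmult_1_l.
Qed.

(** The zeros of [U_n] lie in [(-1, 1)]: outside this interval the recurrence
    makes [|U_n|] nondecreasing in [n], starting from [U_0 = 1]. *)
Lemma chebyshev_U_ge_1 (n : nat) (x : R) :
  1 <= Rabs x -> 1 <= Rabs (chebyshev_U n x).
Proof.
  intro Hx.
  enough (1 <= Rabs (chebyshev_U n x) <= Rabs (chebyshev_U (S n) x)) by tauto.
  induction n as [|n [IH1 IH2]].
  - simpl; rewrite Rabs_R1, Rabs_mult, (Rabs_right 2); lra.
  - split; [lra|].
    rewrite chebyshev_U_SS.
    pose proof (Rabs_triang_inv (2 * x * chebyshev_U (S n) x) (chebyshev_U n x))
      as Ht.
    rewrite !Rabs_mult, (Rabs_right 2) in Ht by lra.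
    nra.
Qed.

(** * Smoothness of trigonometric rational functions *)

(** This class is stable under both partial derivatives off the lines
    [cos u = 0], so smoothness there follows by induction on the order of
    differentiation.  The iterated partial derivatives of a given function are
    never computed.  [trig_ext] makes membership insensitive to the syntactic
    form of the function. *)
Inductive trig_rational : (R -> R -> R) -> Prop :=
| trig_const c : trig_rational (fun _ _ => c)
| trig_cos1 : trig_rational (fun u _ => cos u)
| trig_sin1 : trig_rational (fun u _ => sin u)
| trig_cos2 : trig_rational (fun _ v => cos v)
| trig_sin2 : trig_rational (fun _ v => sin v)
| trig_plus f g : trig_rational f -> trig_rational g ->
    trig_rational (fun u v => f u v + g u v)
| trig_mult f g : trig_rational f -> trig_rational g ->
    trig_rational (fun u v => f u v * g u v)
| trig_inv f : trig_rational f ->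
    (forall u v, cos u <> 0 -> f u v <> 0) ->
    trig_rational (fun u v => / f u v)
| trig_ext f g : trig_rational f -> (forall u v, f u v = g u v) ->
    trig_rational g.

Lemma continuity_2d_pt_comp_fst (f : R -> R) (x y : R) :
  continuity f -> continuity_2d_pt (fun u _ => f u) x y.
Proof.
  intro Hf; apply (continuity_1d_2d_pt_comp f (fun u _ => u));
    [apply Hf|apply continuity_2d_pt_id1].
Qed.

Lemma continuity_2d_pt_comp_snd (f : R -> R) (x y : R) :
  continuity f -> continuity_2d_pt (fun _ v => f v) x y.
Proof.
  intro Hf; apply (continuity_1d_2d_pt_comp f (fun _ v => v));
    [apply Hf|apply continuity_2d_pt_id2].
Qed.

Lemma trig_rational_continuous (f : R -> R -> R) :
  trig_rational f -> forall u v, cos u <> 0 -> continuity_2d_pt f u v.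
Proof.
  induction 1 as [c| | | | |f g _ IHf _ IHg|f g _ IHf _ IHg|f _ IHf Hf|f g _ IHf E];
    intros u v Hu.
  - apply continuity_2d_pt_const.
  - apply continuity_2d_pt_comp_fst, continuity_cos.
  - apply continuity_2d_pt_comp_fst, continuity_sin.
  - apply continuity_2d_pt_comp_snd, continuity_cos.
  - apply continuity_2d_pt_comp_snd, continuity_sin.
  - now apply continuity_2d_pt_plus; auto.
  - now apply continuity_2d_pt_mult; auto.
  - apply continuity_2d_pt_inv; auto.
  - apply continuity_2d_pt_ext with f; auto.
Qed.

Lemma trig_rational_opp (f : R -> R -> R) :
  trig_rational f -> trig_rational (fun u v => - f u v).
Proof.
  intro Hf.
  apply trig_ext with (fun u v => - 1 * f u v).
  - apply trig_mult; [apply trig_const|exact Hf].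
  - intros; ring.
Qed.

Lemma trig_rational_derive (f : R -> R -> R) :
  trig_rational f ->
  exists fx fy, trig_rational fx /\ trig_rational fy /\
    forall u v, cos u <> 0 ->
      is_derive (fun z => f z v) u (fx u v) /\
      is_derive (fun z => f u z) v (fy u v).
Proof.
  induction 1 as [c| | | | |f g Tf (fx & fy & Tfx & Tfy & Df) Tg (gx & gy & Tgx & Tgy & Dg)
    |f g Tf (fx & fy & Tfx & Tfy & Df) Tg (gx & gy & Tgx & Tgy & Dg)
    |f Tf (fx & fy & Tfx & Tfy & Df) Hf|f g Tf (fx & fy & Tfx & Tfy & Df) E].
  - exists (fun _ _ => 0), (fun _ _ => 0).
    split; [apply trig_const|split; [apply trig_const|]].
    intros u v _; split; auto_derive; trivial.
  - exists (fun u _ => - sin u), (fun _ _ => 0).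
    split; [apply trig_rational_opp, trig_sin1|split; [apply trig_const|]].
    intros u v _; split; auto_derive; trivial; ring.
  - exists (fun u _ => cos u), (fun _ _ => 0).
    split; [apply trig_cos1|split; [apply trig_const|]].
    intros u v _; split; auto_derive; trivial; ring.
  - exists (fun _ _ => 0), (fun _ v => - sin v).
    split; [apply trig_const|split; [apply trig_rational_opp, trig_sin2|]].
    intros u v _; split; auto_derive; trivial; ring.
  - exists (fun _ _ => 0), (fun _ v => cos v).
    split; [apply trig_const|split; [apply trig_cos2|]].
    intros u v _; split; auto_derive; trivial; ring.
  - exists (fun u v => fx u v + gx u v), (fun u v => fy u v + gy u v).
    split; [|split]; try (apply trig_plus; assumption).
    intros u v Hu; specialize (Df u v Hu); specialize (Dg u v Hu).
    split; [apply (is_derive_plus (fun z => f z v) (fun z => g z v))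
           |apply (is_derive_plus (fun z => f u z) (fun z => g u z))]; tauto.
  - exists (fun u v => fx u v * g u v + f u v * gx u v),
      (fun u v => fy u v * g u v + f u v * gy u v).
    split; [|split]; try (apply trig_plus; apply trig_mult; assumption).
    intros u v Hu; specialize (Df u v Hu); specialize (Dg u v Hu).
    split; [apply (is_derive_mult (fun z => f z v) (fun z => g z v))
           |apply (is_derive_mult (fun z => f u z) (fun z => g u z))];
      try tauto; exact Rmult_comm.
  - exists (fun u v => - fx u v * / (f u v * f u v)),
      (fun u v => - fy u v * / (f u v * f u v)).
    split; [|split].
    1, 2: apply trig_mult; [now apply trig_rational_opp|].
    1, 2: apply trig_inv; [now apply trig_mult|].
    1, 2: intros u v Hu; specialize (Hf u v Hu); now apply Rmult_integral_contrapositive.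
    intros u v Hu; specialize (Df u v Hu); specialize (Hf u v Hu).
    replace (f u v * f u v) with (f u v ^ 2) by ring.
    split; [apply (is_derive_inv (fun z => f z v))|apply (is_derive_inv (fun z => f u z))];
      tauto.
  - exists fx, fy.
    split; [|split]; try assumption.
    intros u v Hu; specialize (Df u v Hu).
    split; [apply is_derive_ext with (fun z => f z v)|apply is_derive_ext with (fun z => f u z)];
      try tauto; intro; apply E.
Qed.

Lemma locally_2d_cos_neq_0 (u v : R) :
  cos u <> 0 -> locally_2d (fun u' _ => cos u' <> 0) u v.
Proof.
  intro Hu.
  apply (continuity_2d_pt_neq_0 (fun u _ => cos u)); [|exact Hu].
  apply continuity_2d_pt_comp_fst, continuity_cos.
Qed.

Lemma trig_rational_ex_diff_n (n : nat) (f : R -> R -> R) :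
  trig_rational f -> forall u v, cos u <> 0 -> ex_diff_n f n u v.
Proof.
  revert f.
  induction n as [|n IH]; intros f Tf u v Hu.
  - simpl; split; [now apply trig_rational_continuous|trivial].
  - destruct (trig_rational_derive f Tf) as (fx & fy & Tfx & Tfy & Df).
    simpl; split; [now apply trig_rational_continuous|].
    split; [exists (fx u v); now apply Df|].
    split; [exists (fy u v); now apply Df|].
    split.
    + apply ex_diff_n_ext_loc with fx; [|now apply IH].
      apply locally_2d_impl with (2 := locally_2d_cos_neq_0 u v Hu).
      apply locally_2d_forall; intros u' v' Hu'.
      symmetry; apply is_derive_unique; now apply Df.
    + apply ex_diff_n_ext_loc with fy; [|now apply IH].
      apply locally_2d_impl with (2 := locally_2d_cos_neq_0 u v Hu).
      apply locally_2d_forall; intros u' v' Hu'.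
      symmetry; apply is_derive_unique; now apply Df.
Qed.

Lemma trig_rational_chebyshev_U (n : nat) (f : R -> R -> R) :
  trig_rational f -> trig_rational (fun u v => chebyshev_U n (f u v)).
Proof.
  intro Tf.
  assert (T2 : trig_rational (fun u v => 2 * f u v))
    by (apply trig_mult; [apply trig_const|exact Tf]).
  enough (trig_rational (fun u v => chebyshev_U n (f u v)) /\
          trig_rational (fun u v => chebyshev_U (S n) (f u v))) by tauto.
  induction n as [|n [IH1 IH2]].
  - split; [exact (trig_const 1)|exact T2].
  - split; [exact IH2|].
    apply (trig_plus (fun u v => 2 * f u v * chebyshev_U (S n) (f u v))
             (fun u v => - chebyshev_U n (f u v))).
    + now apply (trig_mult (fun u v => 2 * f u v)).
    + now apply trig_rational_opp.
Qed.

Lemma trig_rational_sqr (f : R -> R -> R) :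
  trig_rational f -> trig_rational (fun u v => f u v ^ 2).
Proof.
  intro Tf.
  apply trig_ext with (fun u v => f u v * f u v); [now apply trig_mult|].
  intros; ring.
Qed.

(** * The transmission profile *)

(** [coef_A] is half the sum of [th2 / th1] and its inverse. *)
Lemma coef_A_ge_1 (th1 th2 : R) : 0 < th1 -> 0 < th2 -> 1 <= coef_A th1 th2.
Proof.
  intros H1 H2; unfold coef_A.
  assert (0 < 2 * th1 * th2) by nra.
  apply Rle_div_r; [assumption|].
  pose proof (pow2_ge_0 (th1 - th2)); nra.
Qed.

Lemma coef_B_pos (th1 th2 th3 : R) :
  0 < th1 -> 0 < th2 -> 0 < th3 -> 0 < coef_B th1 th2 th3.
Proof.
  intros H1 H2 H3; unfold coef_B.
  apply Rdiv_lt_0_compat; nra.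
Qed.

Lemma profile_weight_nonneg (A B c s : R) :
  1 <= A -> 0 <= (A ^ 2 - 1) * c ^ 2 + B ^ 2 * s ^ 2.
Proof.
  intro HA.
  apply Rplus_le_le_0_compat; apply Rmult_le_pos; try apply pow2_ge_0; nra.
Qed.

Lemma profile_denominator_pos (A B phi U : R) :
  1 <= A -> cos phi <> 0 ->
  0 < cos phi ^ 2 +
      ((A ^ 2 - 1) * cos phi ^ 2 + B ^ 2 * sin phi ^ 2) * U ^ 2.
Proof.
  intros HA Hc.
  pose proof (profile_weight_nonneg A B (cos phi) (sin phi) HA).
  pose proof (pow2_ge_0 U).
  pose proof (pow2_gt_0 _ Hc); nra.
Qed.

Lemma profile_periodic_phi (N : nat) (A B phi psi : R) :
  profile N A B (phi + PI) psi = profile N A B phi psi.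
Proof.
  unfold profile, tan.
  rewrite neg_cos, neg_sin.
  replace (- sin phi / - cos phi) with (sin phi / cos phi)
    by (unfold Rdiv; rewrite Rinv_opp; ring).
  now rewrite <- !Rsqr_pow2, <- !Rsqr_neg.
Qed.

(** A shift of [psi] by [PI] only changes the sign of the argument of [U]. *)
Lemma profile_periodic_psi (N : nat) (A B phi psi : R) :
  profile N A B phi (psi + PI) = profile N A B phi psi.
Proof.
  unfold profile.
  rewrite neg_cos, neg_sin.
  replace (A * - cos psi - B * tan phi * - sin psi)
    with (- (A * cos psi - B * tan phi * sin psi)) by ring.
  now rewrite chebyshev_U_opp_sqr.
Qed.

Lemma profile_bounds (N : nat) (A B phi psi : R) :
  1 <= A -> cos phi <> 0 -> 0 <= profile N A B phi psi <= 1.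
Proof.
  intros HA Hc; unfold profile.
  set (U := chebyshev_U _ _).
  pose proof (profile_denominator_pos A B phi U HA Hc) as HD.
  pose proof (profile_weight_nonneg A B (cos phi) (sin phi) HA) as HW.
  pose proof (pow2_ge_0 (cos phi)); pose proof (pow2_ge_0 U).
  split.
  - now apply Rdiv_le_0_compat.
  - apply Rle_div_l; [exact HD|nra].
Qed.

Lemma trig_rational_profile (N : nat) (A B : R) :
  1 <= A -> trig_rational (profile N A B).
Proof.
  intro HA.
  assert (Tc2 : trig_rational (fun u _ => cos u ^ 2))
    by exact (trig_rational_sqr _ trig_cos1).
  unfold profile, Rdiv.
  apply (trig_mult (fun u _ => cos u ^ 2)); [exact Tc2|].
  apply trig_inv; [|intros u v Hu; apply Rgt_not_eq, profile_denominator_pos; assumption].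
  apply (trig_plus (fun u _ => cos u ^ 2)); [exact Tc2|].
  apply (trig_mult
    (fun u _ => (A ^ 2 - 1) * cos u ^ 2 + B ^ 2 * sin u ^ 2)).
  - apply (trig_plus (fun u _ => (A ^ 2 - 1) * cos u ^ 2)).
    + apply (trig_mult (fun _ _ => A ^ 2 - 1)); [apply trig_const|exact Tc2].
    + apply (trig_mult (fun _ _ => B ^ 2)); [apply trig_const|].
      exact (trig_rational_sqr _ trig_sin1).
  - apply trig_rational_sqr, trig_rational_chebyshev_U.
    apply (trig_plus (fun _ v => A * cos v)).
    + apply (trig_mult (fun _ _ => A)); [apply trig_const|apply trig_cos2].
    + apply trig_rational_opp.
      apply (trig_mult (fun u _ => B * tan u)); [|apply trig_sin2].
      apply (trig_mult (fun _ _ => B)); [apply trig_const|].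
      apply (trig_mult (fun u _ => sin u)); [apply trig_sin1|].
      apply trig_inv; [apply trig_cos1|tauto].
Qed.

(** Near a line [cos phi = 0] the argument [xi] of [U_(N-1)] is unbounded, so
    that eventually [|U_(N-1)(xi)| >= 1]; the hypothesis is [|xi| >= 1] with
    denominators cleared. *)
Lemma profile_le_cot_sqr (N : nat) (A B phi psi : R) :
  1 <= A -> 0 < B ->
  cos phi <> 0 -> sin phi <> 0 ->
  cos phi ^ 2 <= (A * cos psi * cos phi - B * sin phi * sin psi) ^ 2 ->
  profile N A B phi psi <= cos phi ^ 2 * / (B ^ 2 * sin phi ^ 2).
Proof.
  intros HA HB Hc Hs Hxi; unfold profile.
  set (xi := A * cos psi - B * tan phi * sin psi).
  assert (HU : 1 <= chebyshev_U (N - 1) xi ^ 2).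
  { rewrite <- (pow2_abs (chebyshev_U _ _)).
    enough (1 <= Rabs (chebyshev_U (N - 1) xi)) by nra.
    apply chebyshev_U_ge_1.
    assert (E : A * cos psi * cos phi - B * sin phi * sin psi = xi * cos phi)
      by (unfold xi, tan; now field).
    rewrite E, Rpow_mult_distr in Hxi.
    pose proof (pow2_gt_0 _ Hc).
    assert (1 <= xi ^ 2) by nra.
    rewrite <- (pow2_abs xi) in H0.
    pose proof (Rabs_pos xi); nra. }
  pose proof (pow2_gt_0 _ Hc) as Hc2; pose proof (pow2_gt_0 _ Hs) as Hs2.
  assert (0 < B ^ 2) by nra.
  assert (HP : 0 < B ^ 2 * sin phi ^ 2) by now apply Rmult_lt_0_compat.
  apply Rmult_le_compat_l; [lra|].
  apply Rinv_le_contravar; [exact HP|].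
  assert (0 <= (A ^ 2 - 1) * cos phi ^ 2) by (apply Rmult_le_pos; nra).
  nra.
Qed.

Lemma continuity_2d_pt_pos (f : R -> R -> R) (x y : R) :
  continuity_2d_pt f x y -> 0 < f x y -> locally_2d (fun u v => 0 < f u v) x y.
Proof.
  intros Hf Hpos.
  apply locally_2d_impl with (2 := Hf (mkposreal _ Hpos)).
  apply locally_2d_forall; simpl; intros u v Huv.
  apply Rabs_def2 in Huv; lra.
Qed.

Lemma profile_ext_continuous (N : nat) (A B phi psi : R) :
  1 <= A -> 0 < B -> ~ lattice phi psi -> continuity_2d_pt (profile_ext N A B) phi psi.
Proof.
  intros HA HB HL.
  destruct (Req_dec (cos phi) 0) as [Hc|Hc].
  2: { apply continuity_2d_pt_ext_loc with (profile N A B).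
       - apply locally_2d_impl with (2 := locally_2d_cos_neq_0 phi psi Hc).
         apply locally_2d_forall; intros u v Hu; unfold profile_ext.
         now destruct (Req_EM_T (cos u) 0).
       - now apply trig_rational_continuous; [apply trig_rational_profile|]. }
  assert (Hspsi : sin psi <> 0).
  { intro Hs; apply HL.
    destruct (cos_eq_0_0 _ Hc) as [n Hn]; destruct (sin_eq_0_0 _ Hs) as [m Hm].
    exists (n + 1)%Z, m; rewrite plus_IZR; split; lra. }
  assert (Hsphi : sin phi ^ 2 = 1).
  { pose proof (sin2_cos2 phi) as E; unfold Rsqr in E; rewrite Hc in E; nra. }
  set (G := fun u v : R =>
    (A * cos v * cos u - B * sin u * sin v) ^ 2 + (- 1) * cos u ^ 2).
  set (H := fun u (_ : R) => cos u ^ 2 * / (B ^ 2 * sin u ^ 2)).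
  assert (Cc1 : continuity_2d_pt (fun u _ => cos u) phi psi)
    by apply continuity_2d_pt_comp_fst, continuity_cos.
  assert (Cs1 : continuity_2d_pt (fun u _ => sin u) phi psi)
    by apply continuity_2d_pt_comp_fst, continuity_sin.
  assert (Cc2 : continuity_2d_pt (fun _ v => cos v) phi psi)
    by apply continuity_2d_pt_comp_snd, continuity_cos.
  assert (Cs2 : continuity_2d_pt (fun _ v => sin v) phi psi)
    by apply continuity_2d_pt_comp_snd, continuity_sin.
  assert (Csq : forall f, continuity_2d_pt f phi psi ->
            continuity_2d_pt (fun u v => f u v ^ 2) phi psi).
  { intros f Cf.
    apply continuity_2d_pt_ext with (fun u v => f u v * f u v);
      [intros; ring|now apply continuity_2d_pt_mult]. }
  assert (Ck : forall c, continuity_2d_pt (fun _ _ => c) phi psi)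
    by (intro; apply continuity_2d_pt_const).
  assert (CG : continuity_2d_pt G phi psi).
  { apply continuity_2d_pt_plus.
    - apply Csq, continuity_2d_pt_minus.
      + now repeat apply continuity_2d_pt_mult.
      + now repeat apply continuity_2d_pt_mult.
    - apply continuity_2d_pt_mult; auto. }
  assert (CH : continuity_2d_pt H phi psi).
  { apply continuity_2d_pt_mult; [auto|].
    apply continuity_2d_pt_inv; [apply continuity_2d_pt_mult; auto|].
    rewrite Hsphi; nra. }
  assert (G0 : 0 < G phi psi).
  { unfold G; rewrite Hc.
    replace (_ + _) with ((B ^ 2 * sin psi ^ 2) * sin phi ^ 2) by ring.
    rewrite Hsphi, Rmult_1_r.
    apply Rmult_lt_0_compat; [nra|now apply pow2_gt_0]. }
  assert (H0 : H phi psi = 0) by (unfold H; rewrite Hc; ring).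
  assert (Ls : locally_2d (fun u v => sin u <> 0) phi psi).
  { apply (continuity_2d_pt_neq_0 (fun u _ => sin u)); [exact Cs1|].
    intro E; rewrite E in Hsphi; lra. }
  intro eps.
  specialize (CH eps).
  apply locally_2d_impl with (2 := locally_2d_and _ _ _ _ CH
    (locally_2d_and _ _ _ _ Ls (continuity_2d_pt_pos G phi psi CG G0))).
  apply locally_2d_forall; intros u v (HH & Hs & HG).
  rewrite H0, Rminus_0_r in HH.
  unfold profile_ext at 2.
  destruct (Req_EM_T (cos phi) 0) as [_|]; [|contradiction].
  rewrite Rminus_0_r; unfold profile_ext.
  destruct (Req_EM_T (cos u) 0) as [_|Hu].
  - rewrite Rabs_R0; apply cond_pos.
  - rewrite Rabs_right by (apply Rle_ge; now apply profile_bounds).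
    apply Rle_lt_trans with (2 := HH), Rle_trans with (2 := Rle_abs _).
    apply profile_le_cot_sqr; try assumption.
    unfold G in HG; lra.
Qed.

(** * Plane waves on an edge *)

(** The solution of [f'' + k^2 f = 0] with [f = y] and [f' = k z] at [x0]; its
    derivative is [k] times [wave k x0 z (- y)]. *)
Definition wave (k x0 : R) (y z : C) (x : R) : C :=
  (y * RtoC (cos (k * (x - x0))) + z * RtoC (sin (k * (x - x0))))%C.

Lemma wave_fst (k x0 : R) (y z : C) (x : R) :
  fst (wave k x0 y z x) =
  fst y * cos (k * (x - x0)) + fst z * sin (k * (x - x0)).
Proof. unfold wave; simpl; ring. Qed.

Lemma wave_snd (k x0 : R) (y z : C) (x : R) :
  snd (wave k x0 y z x) =
  snd y * cos (k * (x - x0)) + snd z * sin (k * (x - x0)).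
Proof. unfold wave; simpl; ring. Qed.

Lemma wave_start (k x0 : R) (y z : C) : wave k x0 y z x0 = y.
Proof.
  unfold wave; rewrite Rminus_diag, Rmult_0_r, cos_0, sin_0; ring.
Qed.

(** Complex-valued functions of a real variable are differentiated by
    components, to which the real calculus applies. *)
Lemma is_derive_C (f : R -> C) (x : R) (d : C) :
  is_derive (fun t => fst (f t)) x (fst d) ->
  is_derive (fun t => snd (f t)) x (snd d) ->
  @is_derive R_AbsRing C_R_NormedModule f x d.
Proof.
  intros H1 H2.
  pose proof (is_derive_plus _ _ _ _ _
    (is_derive_scal_l (V := C_R_NormedModule) _ _ _ (1, 0) H1)
    (is_derive_scal_l (V := C_R_NormedModule) _ _ _ (0, 1) H2)) as H.
  replace d with (plus (scal (fst d) ((1, 0) : C_R_NormedModule))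
                       (scal (snd d) ((0, 1) : C_R_NormedModule))).
  - apply is_derive_ext with (2 := H).
    intro t; apply injective_projections; simpl; unfold plus, scal; simpl;
      unfold mult; simpl; ring.
  - apply injective_projections; simpl; unfold plus, scal; simpl;
      unfold mult; simpl; ring.
Qed.

Lemma is_derive_fst (f : R -> C) (x : R) (d : C) :
  @is_derive R_AbsRing C_R_NormedModule f x d ->
  is_derive (fun t => fst (f t)) x (fst d).
Proof.
  intro H.
  eapply filterdiff_ext_lin.
  - apply (filterdiff_comp' (K := R_AbsRing) (V := C_R_NormedModule)
             (W := R_NormedModule) f (fun w => fst w) x _ (fun w => fst w) H).
    apply filterdiff_linear, (is_linear_fst (U := R_NormedModule) (V := R_NormedModule)).
  - reflexivity.
Qed.

Lemma is_derive_snd (f : R -> C) (x : R) (d : C) :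
  @is_derive R_AbsRing C_R_NormedModule f x d ->
  is_derive (fun t => snd (f t)) x (snd d).
Proof.
  intro H.
  eapply filterdiff_ext_lin.
  - apply (filterdiff_comp' (K := R_AbsRing) (V := C_R_NormedModule)
             (W := R_NormedModule) f (fun w => snd w) x _ (fun w => snd w) H).
    apply filterdiff_linear, (is_linear_snd (U := R_NormedModule) (V := R_NormedModule)).
  - reflexivity.
Qed.

Lemma is_derive_wave (k x0 : R) (y z : C) (x : R) :
  @is_derive R_AbsRing C_R_NormedModule (wave k x0 y z) x
    (RtoC k * wave k x0 z (- y) x)%C.
Proof.
  apply is_derive_C.
  - apply is_derive_ext with (1 := fun t => eq_sym (wave_fst k x0 y z t)).
    auto_derive; trivial; simpl; unfold Rminus; ring.
  - apply is_derive_ext with (1 := fun t => eq_sym (wave_snd k x0 y z t)).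
    auto_derive; trivial; simpl; unfold Rminus; ring.
Qed.

Lemma helmholtz_wave (k x0 : R) (y z : C) (D : R -> Prop) :
  helmholtz_on k D (wave k x0 y z).
Proof.
  exists (fun x => RtoC k * wave k x0 z (- y) x)%C,
    (fun x => RtoC k * (RtoC k * wave k x0 (- y) (- z) x))%C.
  intros x _; split; [apply is_derive_wave|split].
  - pose proof (is_derive_scal (fun x => fst (wave k x0 z (- y) x)) x k _
      (is_derive_fst _ _ _ (is_derive_wave k x0 z (- y)%C x))) as H1.
    pose proof (is_derive_scal (fun x => snd (wave k x0 z (- y) x)) x k _
      (is_derive_snd _ _ _ (is_derive_wave k x0 z (- y)%C x))) as H2.
    apply is_derive_C.
    + replace (fst (RtoC k * (RtoC k * wave k x0 (- y) (- z) x))%C)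
        with (k * fst (RtoC k * wave k x0 (- y) (- z) x)%C) by (simpl; ring).
      apply is_derive_ext with (2 := H1); intro t; simpl; ring.
    + replace (snd (RtoC k * (RtoC k * wave k x0 (- y) (- z) x))%C)
        with (k * snd (RtoC k * wave k x0 (- y) (- z) x)%C) by (simpl; ring).
      apply is_derive_ext with (2 := H2); intro t; simpl; ring.
  - unfold wave; apply injective_projections; simpl; ring.
Qed.

Lemma derive_zero_constant (D : R -> Prop) (f : R -> R) :
  (forall x y z, D x -> D y -> x <= z <= y -> D z) ->
  (forall x, D x -> is_derive f x 0) ->
  forall x y, D x -> D y -> f x = f y.
Proof.
  intros HD Hf x y Hx Hy.
  destruct (Rtotal_order x y) as [H|[H|H]].
  - apply (eq_is_derive f x y); [|exact H].
    intros t Ht; apply Hf, (HD x y); assumption.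
  - now rewrite H.
  - symmetry; apply (eq_is_derive f y x); [|exact H].
    intros t Ht; apply Hf, (HD y x); assumption.
Qed.

(** The coefficients are found by variation of constants: rotating the vector
    [(u, u' / k)] back by the angle [k (x - x0)] gives a constant. *)
Lemma oscillator_solution (k x0 p : R) (D : R -> Prop) (u u' u'' : R -> R) :
  k <> 0 ->
  (forall x y z, D x -> D y -> x <= z <= y -> D z) -> D p ->
  (forall x, D x -> is_derive u x (u' x) /\ is_derive u' x (u'' x) /\
     u'' x = - k ^ 2 * u x) ->
  exists a b, forall x, D x ->
    u x = a * cos (k * (x - x0)) + b * sin (k * (x - x0)).
Proof.
  intros Hk HD Hp Hu.
  set (a := fun x => u x * cos (k * (x - x0)) - u' x * sin (k * (x - x0)) / k).
  set (b := fun x => u x * sin (k * (x - x0)) + u' x * cos (k * (x - x0)) / k).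
  assert (Ea : forall x, D x -> a x = a p).
  { intros x Hx; apply (derive_zero_constant D); try assumption.
    intros t Ht; destruct (Hu t Ht) as (H1 & H2 & H3); unfold a.
    auto_derive.
    - assert (ex_derive u t) by now exists (u' t).
      assert (ex_derive u' t) by now exists (u'' t).
      tauto.
    - apply is_derive_unique in H1; apply is_derive_unique in H2.
      change (fun x => u x) with u; change (fun x => u' x) with u'.
      rewrite H1, H2, H3.
      now field. }
  assert (Eb : forall x, D x -> b x = b p).
  { intros x Hx; apply (derive_zero_constant D); try assumption.
    intros t Ht; destruct (Hu t Ht) as (H1 & H2 & H3); unfold b.
    auto_derive.
    - assert (ex_derive u t) by now exists (u' t).
      assert (ex_derive u' t) by now exists (u'' t).
      tauto.
    - apply is_derive_unique in H1; apply is_derive_unique in H2.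
      change (fun x => u x) with u; change (fun x => u' x) with u'.
      rewrite H1, H2, H3.
      now field. }
  exists (a p), (b p); intros x Hx.
  rewrite <- (Ea x Hx), <- (Eb x Hx); unfold a, b.
  pose proof (sin2_cos2 (k * (x - x0))) as E; unfold Rsqr in E.
  rewrite <- (Rmult_1_r (u x)) at 1; rewrite <- E.
  now field.
Qed.

Lemma helmholtz_on_wave (k x0 p : R) (D : R -> Prop) (f : R -> C) :
  k <> 0 ->
  (forall x y z, D x -> D y -> x <= z <= y -> D z) -> D p ->
  helmholtz_on k D f ->
  exists y z, forall x, D x -> f x = wave k x0 y z x.
Proof.
  intros Hk HD Hp (f' & f'' & Hf).
  destruct (oscillator_solution k x0 p D (fun x => fst (f x))
    (fun x => fst (f' x)) (fun x => fst (f'' x)) Hk HD Hp) as (a1 & b1 & H1).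
  { intros x Hx; destruct (Hf x Hx) as (E1 & E2 & E3).
    split; [now apply is_derive_fst|split; [now apply is_derive_fst|]].
    apply (f_equal fst) in E3; simpl in E3; simpl; lra. }
  destruct (oscillator_solution k x0 p D (fun x => snd (f x))
    (fun x => snd (f' x)) (fun x => snd (f'' x)) Hk HD Hp) as (a2 & b2 & H2).
  { intros x Hx; destruct (Hf x Hx) as (E1 & E2 & E3).
    split; [now apply is_derive_snd|split; [now apply is_derive_snd|]].
    apply (f_equal snd) in E3; simpl in E3; simpl; lra. }
  exists (a1, a2), (b1, b2); intros x Hx.
  apply injective_projections.
  - rewrite wave_fst; now apply H1.
  - rewrite wave_snd; now apply H2.
Qed.

(** * Traces at the ends of an edge *)

Lemma filterlim_C (F : (R -> Prop) -> Prop) (FF : Filter F) (g : R -> C) (a : C) :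
  filterlim (fun s => fst (g s)) F (locally (fst a)) ->
  filterlim (fun s => snd (g s)) F (locally (snd a)) ->
  filterlim g F (@locally C_UniformSpace a).
Proof.
  intros H1 H2; apply filterlim_locally; intro eps.
  pose proof (proj1 (filterlim_locally _ _) H1 eps) as E1.
  pose proof (proj1 (filterlim_locally _ _) H2 eps) as E2.
  exact (filter_and _ _ E1 E2).
Qed.

Lemma at_right_pos (eps : R) :
  0 < eps -> at_right 0 (fun s => 0 < s < eps).
Proof.
  intro He; exists (mkposreal eps He); intros s Hs Hs0.
  unfold ball in Hs; simpl in Hs; unfold AbsRing_ball, abs, minus, plus, opp in Hs.
  simpl in Hs; apply Rabs_def2 in Hs; lra.
Qed.

Lemma derive_quotient_at_right (u : R -> R) (d : R) :
  is_derive u 0 d ->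
  filterlim (fun s => (u s - u 0) / s) (at_right 0) (locally d).
Proof.
  intro H; apply is_derive_Reals in H.
  apply filterlim_locally; intro eps.
  destruct (H eps (cond_pos eps)) as [del Hdel].
  apply filter_imp with (2 := at_right_pos del (cond_pos del)).
  intros s Hs.
  specialize (Hdel s); rewrite Rplus_0_l in Hdel.
  apply Hdel; [lra|rewrite Rabs_right; lra].
Qed.

Lemma edge_trace_of_derive (g : R -> C) (d : C) :
  is_derive (fun s => fst (g s)) 0 (fst d) ->
  is_derive (fun s => snd (g s)) 0 (snd d) ->
  edge_trace g (g 0) d.
Proof.
  intros H1 H2; split.
  - apply filterlim_C; [apply _| |];
      (eapply filterlim_filter_le_1; [apply filter_le_within|]).
    + apply (ex_derive_continuous (fun s => fst (g s))); now exists (fst d).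
    + apply (ex_derive_continuous (fun s => snd (g s))); now exists (snd d).
  - apply filterlim_C; [apply _| |].
    + apply filterlim_ext_loc with (2 := derive_quotient_at_right _ _ H1).
      apply filter_imp with (2 := at_right_pos 1 Rlt_0_1).
      intros s Hs; simpl; field; lra.
    + apply filterlim_ext_loc with (2 := derive_quotient_at_right _ _ H2).
      apply filter_imp with (2 := at_right_pos 1 Rlt_0_1).
      intros s Hs; simpl; field; lra.
Qed.

Lemma edge_trace_ext (eps : R) (g g' : R -> C) (a d : C) :
  0 < eps -> (forall s, 0 < s < eps -> g s = g' s) ->
  edge_trace g a d -> edge_trace g' a d.
Proof.
  intros He E [H1 H2]; split.
  - apply filterlim_ext_loc with (2 := H1).
    now apply filter_imp with (2 := at_right_pos eps He).
  - apply filterlim_ext_loc with (2 := H2).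
    apply filter_imp with (2 := at_right_pos eps He).
    intros s Hs; now rewrite E.
Qed.

Lemma edge_trace_unique (g : R -> C) (a d a' d' : C) :
  edge_trace g a d -> edge_trace g a' d' -> a' = a /\ d' = d.
Proof.
  intros [H1 H2] [H1' H2'].
  assert (E : a' = a)
    by exact (@filterlim_locally_unique _ R_AbsRing C_R_NormedModule
                (at_right 0) _ _ _ _ H1' H1).
  split; [exact E|rewrite E in H2'].
  exact (@filterlim_locally_unique _ R_AbsRing C_R_NormedModule
           (at_right 0) _ _ _ _ H2' H2).
Qed.

Lemma edge_trace_wave_right (k x0 x1 : R) (y z : C) :
  edge_trace (fun s => wave k x0 y z (x1 + s))
    (wave k x0 y z x1) (RtoC k * wave k x0 z (- y) x1)%C.
Proof.
  replace (wave k x0 y z x1) with (wave k x0 y z (x1 + 0)) by (f_equal; ring).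
  apply (edge_trace_of_derive (fun s => wave k x0 y z (x1 + s))).
  - apply is_derive_ext with (1 := fun t => eq_sym (wave_fst k x0 y z (x1 + t))).
    auto_derive; trivial; rewrite Rplus_0_r; simpl; unfold Rminus; ring.
  - apply is_derive_ext with (1 := fun t => eq_sym (wave_snd k x0 y z (x1 + t))).
    auto_derive; trivial; rewrite Rplus_0_r; simpl; unfold Rminus; ring.
Qed.

Lemma edge_trace_wave_left (k x0 x1 : R) (y z : C) :
  edge_trace (fun s => wave k x0 y z (x1 - s))
    (wave k x0 y z x1) (- (RtoC k * wave k x0 z (- y) x1))%C.
Proof.
  replace (wave k x0 y z x1) with (wave k x0 y z (x1 - 0)) by (f_equal; ring).
  apply (edge_trace_of_derive (fun s => wave k x0 y z (x1 - s))).
  - apply is_derive_ext with (1 := fun t => eq_sym (wave_fst k x0 y z (x1 - t))).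
    auto_derive; trivial; rewrite Ropp_0, Rplus_0_r; simpl; unfold Rminus; ring.
  - apply is_derive_ext with (1 := fun t => eq_sym (wave_snd k x0 y z (x1 - t))).
    auto_derive; trivial; rewrite Ropp_0, Rplus_0_r; simpl; unfold Rminus; ring.
Qed.

(** * Resonator modes *)

(** The solutions on a resonator that satisfy the endpoint condition: [del]
    is the phase of the wave reflected at the end [s = l]. *)
Definition resonator_mode (k l del : R) (c : C) : R -> C :=
  wave k l (c * RtoC (cos del)) (- (c * RtoC (sin del))).

Lemma resonator_delta_spec (al be k : R) :
  0 < k -> al * cos (resonator_delta al be k) =
           be * k * sin (resonator_delta al be k).
Proof.
  intro Hk; unfold resonator_delta.
  destruct (Req_EM_T al 0) as [E|Ha].
  - rewrite E, sin_0; ring.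
  - destruct (Req_EM_T be 0) as [E|Hb].
    + rewrite E, cos_PI2; ring.
    + set (x := atan _).
      assert (Hc : cos x <> 0).
      { pose proof (atan_bound (al / (be * k))).
        apply Rgt_not_eq, cos_gt_0; unfold x; lra. }
      assert (Ht : sin x / cos x = al / (be * k))
        by (exact (tan_atan (al / (be * k)))).
      apply (f_equal (fun t => t * (be * k) * cos x)) in Ht.
      field_simplify in Ht; [lra|split; [lra|assumption]|assumption].
Qed.

Lemma resonator_mode_endpoint (k l al be : R) (c : C) (f : graph_function) (j : nat) :
  0 < k ->
  on_resonator f j = resonator_mode k l (resonator_delta al be k) c ->
  endpoint_condition l al be f j.
Proof.
  intros Hk E; unfold endpoint_condition; rewrite E; unfold resonator_mode.
  set (del := resonator_delta al be k).
  exists (c * RtoC (cos del))%C, (- (RtoC k * (c * RtoC (sin del))))%C; split.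
  - pose proof (edge_trace_wave_left k l l
      (c * RtoC (cos del))%C (- (c * RtoC (sin del)))%C) as H.
    rewrite !wave_start in H.
    replace (- - (RtoC k * (c * RtoC (sin del))))%C
      with (- (RtoC k * - (c * RtoC (sin del))))%C by ring.
    exact H.
  - pose proof (resonator_delta_spec al be k Hk) as Hd; fold del in Hd.
    transitivity (c * (RtoC (al * cos del) - RtoC (be * k * sin del)))%C.
    + rewrite !RtoC_mult; ring.
    + rewrite Hd; ring.
Qed.

(** The vector [(al, be k)] is a nonzero multiple of [(sin del, cos del)], so the
    endpoint condition makes the wave data at [s = l] proportional to
    [(cos del, - sin del)]. *)
Lemma endpoint_resonator_mode (k l al be : R) (f : graph_function) (j : nat) :
  0 < k -> 0 < l -> (al, be) <> (0, 0) ->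
  helmholtz_on k (fun s => 0 < s < l) (on_resonator f j) ->
  endpoint_condition l al be f j ->
  exists c, forall s, 0 < s < l ->
    on_resonator f j s = resonator_mode k l (resonator_delta al be k) c s.
Proof.
  intros Hk Hl Hab Hf (a & d & Ht & Hbc).
  destruct (helmholtz_on_wave k l (l / 2) (fun s => 0 < s < l) (on_resonator f j))
    as (y & z & E); [lra|intros; lra|lra|exact Hf|].
  pose proof (edge_trace_wave_left k l l y z) as Hw.
  rewrite !wave_start in Hw.
  assert (Ht' : edge_trace (fun s => wave k l y z (l - s)) a (- d)%C).
  { apply edge_trace_ext with (3 := Ht) (1 := Hl).
    intros s Hs; apply E; lra. }
  destruct (edge_trace_unique _ _ _ _ _ Hw Ht') as [Ea Ed].
  assert (Ed' : d = (RtoC k * z)%C).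
  { replace d with (- - d)%C by ring; rewrite Ed; ring. }
  rewrite Ea, Ed' in Hbc.
  pose proof (resonator_delta_spec al be k Hk) as Hd.
  set (del := resonator_delta al be k) in *.
  pose proof (sin2_cos2 del) as Hsc; unfold Rsqr in Hsc.
  set (rho := al * sin del + be * k * cos del).
  assert (Hal : al = rho * sin del).
  { unfold rho; transitivity (al * (sin del * sin del) + be * k * sin del * cos del);
      [rewrite <- Hd|ring].
    transitivity (al * (sin del * sin del + cos del * cos del)); [rewrite Hsc|]; ring. }
  assert (Hbe : be * k = rho * cos del).
  { unfold rho; transitivity (al * cos del * sin del + be * k * (cos del * cos del));
      [rewrite Hd|ring].
    transitivity (be * k * (sin del * sin del + cos del * cos del)); [rewrite Hsc|]; ring. }
  assert (Hrho : rho <> 0).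
  { intro H0; rewrite H0, Rmult_0_l in Hal, Hbe; apply Hab.
    apply Rmult_integral in Hbe; f_equal; [exact Hal|lra]. }
  assert (Hyz : (y * RtoC (sin del) + z * RtoC (cos del))%C = RtoC 0).
  { assert (H0 : (RtoC rho * (y * RtoC (sin del) + z * RtoC (cos del)))%C = RtoC 0).
    { transitivity (RtoC (rho * sin del) * y + RtoC (rho * cos del) * z)%C;
        [rewrite !RtoC_mult; ring|].
      rewrite <- Hal, <- Hbe, <- Hbc, RtoC_mult; ring. }
    apply (f_equal (fun w => (/ RtoC rho * w)%C)) in H0.
    rewrite Cmult_0_r in H0; rewrite <- H0; field.
    intro HH; apply Hrho; now apply RtoC_inj. }
  assert (HscC : (RtoC (sin del) * RtoC (sin del) + RtoC (cos del) * RtoC (cos del))%C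
                 = RtoC 1) by (rewrite <- !RtoC_mult, <- RtoC_plus, Hsc; reflexivity).
  exists (y * RtoC (cos del) - z * RtoC (sin del))%C.
  intros s Hs; rewrite E by exact Hs; unfold resonator_mode; f_equal.
  - transitivity (y * (RtoC (sin del) * RtoC (sin del) + RtoC (cos del) * RtoC (cos del))
       - RtoC (sin del) * (y * RtoC (sin del) + z * RtoC (cos del)))%C;
      [rewrite HscC, Hyz|]; ring.
  - transitivity (z * (RtoC (sin del) * RtoC (sin del) + RtoC (cos del) * RtoC (cos del))
       - RtoC (cos del) * (y * RtoC (sin del) + z * RtoC (cos del)))%C;
      [rewrite HscC, Hyz|]; ring.
Qed.

Lemma edge_trace_resonator_mode (k l del : R) (c : C) :
  edge_trace (resonator_mode k l del c)
    (c * RtoC (cos (k * l - del)))%C (RtoC k * (c * RtoC (sin (k * l - del))))%C.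
Proof.
  pose proof (edge_trace_wave_right k l 0
    (c * RtoC (cos del))%C (- (c * RtoC (sin del)))%C) as H.
  fold (resonator_mode k l del c) in H.
  replace (resonator_mode k l del c 0) with (c * RtoC (cos (k * l - del)))%C in H.
  - replace (wave k l _ _ 0) with (c * RtoC (sin (k * l - del)))%C in H.
    + apply edge_trace_ext with (1 := Rlt_0_1) (3 := H).
      intros s _; now rewrite Rplus_0_l.
    + unfold wave; replace (k * (0 - l)) with (- (k * l)) by ring.
      rewrite cos_neg, sin_neg, sin_minus.
      unfold Rminus; rewrite RtoC_plus, !RtoC_opp, !RtoC_mult; ring.
  - unfold resonator_mode, wave; replace (k * (0 - l)) with (- (k * l)) by ring.
    rewrite cos_neg, sin_neg, cos_minus, RtoC_plus, !RtoC_opp, !RtoC_mult; ring.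
Qed.

(** * From the graph to a linear system *)

(** The type-I conditions at a vertex, for waves with data [(y, z)] one spacing
    to the left of it and [(y', z')] at its right, [c, s] being the cosine and
    sine of [k h], and for a resonator mode of amplitude [a] and phase [phi]. *)
Definition vertex_relation (th1 th2 th3 c s phi : R) (y z y' z' a : C) : Prop :=
  ((y * RtoC c + z * RtoC s) / RtoC th1)%C = (y' / RtoC th2)%C /\
  (y' / RtoC th2)%C = (a * RtoC (cos phi) / RtoC th3)%C /\
  (RtoC th2 * z' + RtoC th3 * (a * RtoC (sin phi)))%C =
    (RtoC th1 * (z * RtoC c - y * RtoC s))%C.

Lemma Cminus_0_eq (x y : C) : (x - y)%C = RtoC 0 -> x = y.
Proof. intro H; transitivity (x - y + y)%C; [ring|rewrite H; ring]. Qed.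

Lemma RtoC_neq_0 (x : R) : x <> 0 -> RtoC x <> RtoC 0.
Proof. intros Hx E; apply Hx; now apply RtoC_inj. Qed.

(** Traces are unique, so the existentially quantified limits and derivatives in
    the vertex condition can only be those of the waves; the common factor [k]
    of the derivatives cancels. *)
Lemma type_I_condition_iff (N j : nat) (h l th1 th2 th3 k del : R)
    (y z y' z' a : C) (f : graph_function) :
  0 < k -> 0 < h -> 0 < l -> (j < N)%nat ->
  (forall x, in_channel_edge N h j x ->
     on_channel f j x = wave k (vertex_pos h j) y z x) ->
  (forall x, in_channel_edge N h (S j) x ->
     on_channel f (S j) x = wave k (vertex_pos h (S j)) y' z' x) ->
  (forall s, 0 < s < l -> on_resonator f (S j) s = resonator_mode k l del a s) ->
  type_I_condition h th1 th2 th3 f (S j) <->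
  vertex_relation th1 th2 th3 (cos (k * h)) (sin (k * h)) (k * l - del) y z y' z' a.
Proof.
  intros Hk Hh Hl HjN HL HR HM.
  assert (HxS : vertex_pos h (S j) = vertex_pos h j + h)
    by (unfold vertex_pos; rewrite S_INR; ring).
  assert (HxSS : vertex_pos h (S (S j)) = vertex_pos h (S j) + h)
    by (unfold vertex_pos; rewrite (S_INR (S j)); ring).
  assert (TL : edge_trace (fun s => on_channel f j (vertex_pos h (S j) - s))
      (y * RtoC (cos (k * h)) + z * RtoC (sin (k * h)))%C
      (- (RtoC k * (z * RtoC (cos (k * h)) - y * RtoC (sin (k * h)))))%C).
  { pose proof (edge_trace_wave_left k (vertex_pos h j) (vertex_pos h (S j)) y z) as H.
    unfold wave at 2 3 in H.
    replace (vertex_pos h (S j) - vertex_pos h j) with h in H by (rewrite HxS; ring).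
    replace (z * RtoC (cos (k * h)) - y * RtoC (sin (k * h)))%C
      with (z * RtoC (cos (k * h)) + - y * RtoC (sin (k * h)))%C by ring.
    apply edge_trace_ext with (1 := Hh) (3 := H).
    intros s Hs; symmetry; apply HL; split; intros; lra. }
  assert (TR : edge_trace (fun s => on_channel f (S j) (vertex_pos h (S j) + s))
      y' (RtoC k * z')%C).
  { pose proof (edge_trace_wave_right k (vertex_pos h (S j)) (vertex_pos h (S j)) y' z')
      as H.
    rewrite !wave_start in H.
    apply edge_trace_ext with (1 := Hh) (3 := H).
    intros s Hs; symmetry; apply HR; split; intros; lra. }
  assert (TM : edge_trace (fun s => on_resonator f (S j) s)
      (a * RtoC (cos (k * l - del)))%C (RtoC k * (a * RtoC (sin (k * l - del))))%C).
  { apply edge_trace_ext with (1 := Hl) (3 := edge_trace_resonator_mode k l del a).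
    intros s Hs; symmetry; now apply HM. }
  assert (Hk' : RtoC k <> RtoC 0) by (apply RtoC_neq_0; lra).
  unfold type_I_condition, vertex_relation; simpl pred; split.
  - intros (f1 & f2 & f3 & d1 & d2 & d3 & T1 & T2 & T3 & E1 & E2 & E3).
    destruct (edge_trace_unique _ _ _ _ _ TL T1) as [-> ->].
    destruct (edge_trace_unique _ _ _ _ _ TR T2) as [-> ->].
    destruct (edge_trace_unique _ _ _ _ _ TM T3) as [-> ->].
    split; [exact E1|split; [exact E2|]].
    apply (f_equal (fun w => (/ RtoC k * w)%C)) in E3.
    rewrite Cmult_0_r in E3.
    apply Cminus_0_eq; rewrite <- E3; now field.
  - intros (E1 & E2 & E3).
    do 6 eexists; split; [exact TL|split; [exact TR|split; [exact TM|]]].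
    split; [exact E1|split; [exact E2|]].
    transitivity (RtoC k * ((RtoC th2 * z' + RtoC th3 * (a * RtoC (sin (k * l - del))))
      - RtoC th1 * (z * RtoC (cos (k * h)) - y * RtoC (sin (k * h)))))%C; [ring|].
    rewrite E3; ring.
Qed.

Lemma finite_choice {X : Type} (P : nat -> X -> Prop) (n : nat) :
  (forall j, (j <= n)%nat -> exists x, P j x) ->
  exists p, forall j, (j <= n)%nat -> P j (p j).
Proof.
  induction n as [|n IH]; intro H.
  - destruct (H O (le_n _)) as [x Hx].
    exists (fun _ => x); intros j Hj; now replace j with O by lia.
  - destruct IH as [p Hp]; [intros j Hj; apply H; lia|].
    destruct (H (S n) (le_n _)) as [x Hx].
    exists (fun j => if Nat.eqb j (S n) then x else p j); intros j Hj.
    destruct (Nat.eqb_spec j (S n)) as [->|Hne]; [exact Hx|apply Hp; lia].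
Qed.

(** Wave data [(y j, z j)] on the channel edges and mode amplitudes [a j] of the
    resonators at [v_(j+1)].  Edge [0] is referred to the fictitious point [- h],
    where a vertex preceding [v_1] would be; this makes every vertex relation
    take the same form. *)
Definition scattering_system (N : nat) (th1 th2 th3 c s phi : R) (r tau : C)
    (y z a : nat -> C) : Prop :=
  y O = ((1 + r) * RtoC c - Ci * (1 - r) * RtoC s)%C /\
  z O = ((1 + r) * RtoC s + Ci * (1 - r) * RtoC c)%C /\
  y N = tau /\ z N = (Ci * tau)%C /\
  forall j, (j < N)%nat ->
    vertex_relation th1 th2 th3 c s phi (y j) (z j) (y (S j))
      (z (S j)) (a j).

Lemma incoming_lead_wave (k h : R) (r : C) (x : R) :
  (expi (k * x) + r * expi (- (k * x)))%C =
  wave k (vertex_pos h 0)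
    ((1 + r) * RtoC (cos (k * h)) - Ci * (1 - r) * RtoC (sin (k * h)))%C
    ((1 + r) * RtoC (sin (k * h)) + Ci * (1 - r) * RtoC (cos (k * h)))%C x.
Proof.
  unfold wave, vertex_pos, expi.
  replace (k * (x - (INR 0 - 1) * h)) with (k * x + k * h) by (simpl; ring).
  rewrite cos_neg, sin_neg, cos_plus, sin_plus.
  pose proof (sin2_cos2 (k * h)) as E; unfold Rsqr in E.
  set (c := cos (k * h)) in *; set (s := sin (k * h)) in *.
  set (cx := cos (k * x)); set (sx := sin (k * x)).
  destruct r as [r1 r2].
  apply injective_projections; simpl.
  - transitivity ((cx * (1 + r1) + sx * r2) * (s * s + c * c)); [rewrite E|]; ring.
  - transitivity ((sx * (1 - r1) + cx * r2) * (s * s + c * c)); [rewrite E|]; ring.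
Qed.

Lemma outgoing_lead_wave (k h : R) (N : nat) (t : C) (x : R) :
  (t * expi (k * x))%C =
  wave k (vertex_pos h N) (t * expi (k * vertex_pos h N))
    (Ci * (t * expi (k * vertex_pos h N))) x.
Proof.
  unfold wave, expi; set (p := vertex_pos h N).
  replace (k * x) with (k * p + k * (x - p)) by ring.
  rewrite cos_plus, sin_plus; destruct t as [t1 t2].
  apply injective_projections; simpl; ring.
Qed.

Lemma in_channel_edge_convex (N : nat) (h : R) (j : nat) (x y z : R) :
  in_channel_edge N h j x -> in_channel_edge N h j y -> x <= z <= y ->
  in_channel_edge N h j z.
Proof.
  intros [H1 H2] [H3 H4] Hz; split; intro Hj.
  - specialize (H1 Hj); lra.
  - specialize (H4 Hj); lra.
Qed.

(** The explicit forms on the two leads fix the data of the edges [0] and [N];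
    these edges are distinct because [1 <= N]. *)
Lemma scattering_solution_iff (N : nat) (h l th1 th2 th3 al be k : R) (r t : C) :
  (1 <= N)%nat -> 0 < h -> 0 < l -> (al, be) <> (0, 0) -> 0 < k ->
  (exists f, scattering_solution N h l th1 th2 th3 al be k r t f) <->
  (exists y z a, scattering_system N th1 th2 th3 (cos (k * h)) (sin (k * h))
     (resonator_phase l al be k) r (t * expi (k * vertex_pos h N)) y z a).
Proof.
  intros HN Hh Hl Hab Hk; split.
  - intros (f & HC & HRs & HV & HE & Hin & Hout).
    set (y0 := ((1 + r) * RtoC (cos (k * h)) - Ci * (1 - r) * RtoC (sin (k * h)))%C).
    set (z0 := ((1 + r) * RtoC (sin (k * h)) + Ci * (1 - r) * RtoC (cos (k * h)))%C).
    set (tau := (t * expi (k * vertex_pos h N))%C).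
    destruct (finite_choice (fun j (p : C * C) =>
      (forall x, in_channel_edge N h j x ->
         on_channel f j x = wave k (vertex_pos h j) (fst p) (snd p) x) /\
      (j = O -> p = (y0, z0)) /\ (j = N -> p = (tau, (Ci * tau)%C))) N) as [p Hp].
    { intros j Hj.
      destruct (Nat.eq_dec j O) as [->|Hj0]; [|destruct (Nat.eq_dec j N) as [->|HjN]].
      - exists (y0, z0); split; [|split; [reflexivity|intro; lia]].
        intros x Hx; rewrite Hin by exact Hx; apply incoming_lead_wave.
      - exists (tau, (Ci * tau)%C); split; [|split; [intro; lia|reflexivity]].
        intros x Hx; rewrite Hout by exact Hx; apply outgoing_lead_wave.
      - destruct (helmholtz_on_wave k (vertex_pos h j) (vertex_pos h j + h / 2)
          (in_channel_edge N h j) (on_channel f j)) as (y & z & E).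
        + lra.
        + apply in_channel_edge_convex.
        + split; intros _; [lra|].
          unfold vertex_pos; rewrite S_INR; lra.
        + apply HC; lia.
        + exists (y, z); split; [exact E|split; intro; lia]. }
    destruct (finite_choice (fun j (a : C) => (j < N)%nat ->
      forall s, 0 < s < l -> on_resonator f (S j) s =
        resonator_mode k l (resonator_delta al be k) a s) N) as [a Ha].
    { intros j _.
      destruct (Nat.lt_ge_cases j N) as [Hj|Hj]; [|exists (RtoC 0); intro; lia].
      destruct (endpoint_resonator_mode k l al be f (S j)) as [a Ha];
        try assumption; [apply HRs; lia|apply HE; lia|].
      now exists a. }
    exists (fun j => fst (p j)), (fun j => snd (p j)), a.
    destruct (Hp O ltac:(lia)) as (_ & E0 & _); specialize (E0 eq_refl).
    destruct (Hp N (le_n _)) as (_ & _ & EN); specialize (EN eq_refl).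
    unfold scattering_system; rewrite E0, EN.
    repeat (split; [reflexivity|]).
    intros j Hj.
    apply (type_I_condition_iff N j h l th1 th2 th3 k _ _ _ _ _ _ f);
      try assumption.
    + apply Hp; lia.
    + apply Hp; lia.
    + apply Ha; lia.
    + apply HV; lia.
  - intros (y & z & a & E1 & E2 & E3 & E4 & HV).
    set (f := {| on_channel := fun j => wave k (vertex_pos h j) (y j) (z j);
                 on_resonator := fun j =>
                   resonator_mode k l (resonator_delta al be k) (a (pred j)) |}).
    exists f; split; [|split; [|split; [|split; [|split]]]].
    + intros j _; apply helmholtz_wave.
    + intros j _; apply helmholtz_wave.
    + intros [|j] Hj; [lia|].
      apply (type_I_condition_iff N j h l th1 th2 th3 k (resonator_delta al be k)
               (y j) (z j) (y (S j)) (z (S j)) (a j) f);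
        try assumption; try lia; try reflexivity.
      apply HV; lia.
    + intros j _.
      now apply resonator_mode_endpoint with (c := a (pred j)) (1 := Hk).
    + intros x _; simpl; rewrite E1, E2; symmetry; apply incoming_lead_wave.
    + intros x _; simpl; rewrite E3, E4; symmetry; apply outgoing_lead_wave.
Qed.

(** * Solving the linear system *)

(** [chebyshev_U] with its index shifted by one, so that [U_(-1) = 0] is
    covered. *)
Definition shifted_U (n : nat) (xi : R) : R :=
  match n with O => 0 | S m => chebyshev_U m xi end.

Lemma shifted_U_SS (n : nat) (xi : R) :
  shifted_U (S (S n)) xi = 2 * xi * shifted_U (S n) xi - shifted_U n xi.
Proof. destruct n as [|n]; [simpl; ring|reflexivity]. Qed.

(** The left-hand side is the determinant of [U_n M - U_(n-1)] for a unimodular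
    [M] of trace [2 * xi]; that matrix is the power [M^(n+1)]. *)
Lemma shifted_U_det (n : nat) (xi : R) :
  shifted_U (S n) xi ^ 2 - 2 * xi * shifted_U (S n) xi * shifted_U n xi
    + shifted_U n xi ^ 2 = 1.
Proof.
  induction n as [|n IH]; [simpl; ring|].
  rewrite shifted_U_SS; rewrite <- IH; ring.
Qed.

(** The rotation by [k h] along a segment, then the matrix with rows [(q, 0)]
    and [(- p, 1 / q)] of a vertex with its resonator. *)
Definition transfer_relation (q p c s : R) (y z y' z' : C) : Prop :=
  y' = (RtoC q * (y * RtoC c + z * RtoC s))%C /\
  z' = (RtoC (/ q) * (z * RtoC c - y * RtoC s)
        - RtoC p * (y * RtoC c + z * RtoC s))%C.

(** Dividing by [cos phi] expresses the amplitude of the resonator through the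
    field at the vertex. *)
Lemma vertex_relation_transfer (th1 th2 th3 c s phi : R) (y z y' z' : C) :
  0 < th1 -> 0 < th2 -> 0 < th3 -> cos phi <> 0 ->
  (exists a, vertex_relation th1 th2 th3 c s phi y z y' z' a) <->
  transfer_relation (th2 / th1) (2 * coef_B th1 th2 th3 * tan phi) c s y z y' z'.
Proof.
  intros H1 H2 H3 Hc; unfold vertex_relation, transfer_relation, coef_B, tan.
  set (Y := (y * RtoC c + z * RtoC s)%C).
  set (Z := (z * RtoC c - y * RtoC s)%C).
  assert (N1 : RtoC th1 <> RtoC 0) by (apply RtoC_neq_0; lra).
  assert (N2 : RtoC th2 <> RtoC 0) by (apply RtoC_neq_0; lra).
  assert (N3 : RtoC th3 <> RtoC 0) by (apply RtoC_neq_0; lra).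
  assert (Nc : RtoC (cos phi) <> RtoC 0) by (now apply RtoC_neq_0).
  assert (Eq : RtoC (th2 / th1) = (RtoC th2 / RtoC th1)%C)
    by (apply RtoC_div; lra).
  assert (Eq' : RtoC (/ (th2 / th1)) = (RtoC th1 / RtoC th2)%C).
  { rewrite <- RtoC_div by lra; f_equal; field; lra. }
  assert (Ep : RtoC (2 * (th3 ^ 2 / (2 * th1 * th2)) * (sin phi / cos phi)) =
    (RtoC th3 * RtoC th3 * RtoC (sin phi) / (RtoC th1 * RtoC th2 * RtoC (cos phi)))%C).
  { rewrite <- !RtoC_mult, <- RtoC_div.
    - f_equal; field; lra.
    - repeat apply Rmult_integral_contrapositive_currified; lra. }
  rewrite Eq, Eq', Ep; split.
  - intros (a & E1 & E2 & E3).
    assert (Ey : y' = (RtoC th2 / RtoC th1 * Y)%C).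
    { transitivity (RtoC th2 * (y' / RtoC th2))%C; [now field|].
      rewrite <- E1; now field. }
    split; [exact Ey|].
    assert (Ea : a = (RtoC th3 / RtoC (cos phi) * (Y / RtoC th1))%C).
    { rewrite E1, E2; now field. }
    transitivity ((RtoC th1 * Z - RtoC th3 * (a * RtoC (sin phi))) / RtoC th2)%C.
    + rewrite <- E3; now field.
    + rewrite Ea; now field.
  - intros [E1 E2].
    exists (RtoC th3 / RtoC (cos phi) * (Y / RtoC th1))%C.
    rewrite E1, E2; split; [now field|split; now field].
Qed.

(** By Cayley-Hamilton, [M^2 = 2 xi M - 1] for the one-period matrix [M], hence
    [M^(n+1) = U_n(xi) M - U_(n-1)(xi)]. *)
Lemma transfer_power (q p c s xi : R) (N n : nat) (y z : nat -> C) :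
  q <> 0 -> s * s + c * c = 1 -> 2 * xi = q * c + / q * c - p * s ->
  (forall j, (j < N)%nat ->
     transfer_relation q p c s (y j) (z j) (y (S j)) (z (S j))) ->
  (n < N)%nat ->
  y (S n) = (RtoC (shifted_U (S n) xi) * (RtoC q * (y O * RtoC c + z O * RtoC s))
             - RtoC (shifted_U n xi) * y O)%C /\
  z (S n) = (RtoC (shifted_U (S n) xi) *
               (RtoC (/ q) * (z O * RtoC c - y O * RtoC s)
                - RtoC p * (y O * RtoC c + z O * RtoC s))
             - RtoC (shifted_U n xi) * z O)%C.
Proof.
  intros Hq Hcs Hxi HT.
  assert (Hq' : (RtoC q * RtoC (/ q))%C = RtoC 1)
    by (rewrite <- RtoC_mult; f_equal; now field).
  assert (Hs : (RtoC s * RtoC s)%C = (RtoC 1 - RtoC c * RtoC c)%C)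
    by (rewrite <- !RtoC_mult, <- RtoC_minus; f_equal; lra).
  assert (HX : RtoC (2 * xi) =
    (RtoC q * RtoC c + RtoC (/ q) * RtoC c - RtoC p * RtoC s)%C)
    by (rewrite Hxi, RtoC_minus, RtoC_plus, !RtoC_mult; reflexivity).
  induction n as [|n IH]; intro Hn.
  - destruct (HT O Hn) as [E1 E2]; rewrite E1, E2; simpl shifted_U; split; ring.
  - destruct (IH ltac:(lia)) as [I1 I2].
    destruct (HT (S n) Hn) as [E1 E2]; rewrite E1, E2, I1, I2.
    rewrite (shifted_U_SS n), RtoC_minus, RtoC_mult, HX.
    split; ring [Hq' Hs].
Qed.

(** The real matrix with rows [(a, b)] and [(c, d)] carries the data
    [(1 + r, i (1 - r))] of the incoming lead to the data [tau (1, i)] of the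
    outgoing one.  Eliminating [r] leaves [D tau = 2 i (a d - b c)] with
    [D = (b - c) + i (a + d)], and the determinant condition gives
    [|D|^2 = 4 + (a - d)^2 + (b + c)^2], so that [D] cannot vanish. *)
Lemma unimodular_scattering (a b c d : R) :
  a * d - b * c = 1 ->
  exists r0 tau0 : C,
    (forall r tau : C,
      (tau = RtoC a * (1 + r) + RtoC b * (Ci * (1 - r)) /\
       Ci * tau = RtoC c * (1 + r) + RtoC d * (Ci * (1 - r)))%C <->
      r = r0 /\ tau = tau0) /\
    Cmod tau0 ^ 2 = 4 / (4 + ((a - d) ^ 2 + (b + c) ^ 2)).
Proof.
  intro Hdet.
  set (D := (RtoC (b - c) + Ci * RtoC (a + d))%C).
  assert (HD : D <> RtoC 0).
  { intro E; apply (f_equal (fun w => (fst w, snd w))) in E.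
    simpl in E; injection E; intros; nra. }
  assert (Hi : (Ci * Ci)%C = (- RtoC 1)%C)
    by (apply injective_projections; simpl; ring).
  assert (HdC : (RtoC a * RtoC d)%C = (RtoC 1 + RtoC b * RtoC c)%C)
    by (rewrite <- !RtoC_mult, <- RtoC_plus; f_equal; lra).
  exists ((RtoC (b + c) + Ci * RtoC (d - a)) / D)%C, (RtoC 2 * Ci / D)%C; split.
  - intros r tau; split.
    + intros [E1 E2]; split.
      * apply Cminus_0_eq.
        transitivity ((Ci * (RtoC a * (1 + r) + RtoC b * (Ci * (1 - r)) - tau)
          - (RtoC c * (1 + r) + RtoC d * (Ci * (1 - r)) - Ci * tau)) / D)%C.
        -- transitivity ((r * D - (RtoC (b + c) + Ci * RtoC (d - a))) / D)%C;
             [now field|f_equal].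
           unfold D; rewrite !RtoC_minus, !RtoC_plus; ring [Hi].
        -- rewrite <- E1, <- E2; now field.
      * apply Cminus_0_eq.
        transitivity (((RtoC c - Ci * RtoC d) *
            (RtoC a * (1 + r) + RtoC b * (Ci * (1 - r)) - tau)
          - (RtoC a - Ci * RtoC b) *
            (RtoC c * (1 + r) + RtoC d * (Ci * (1 - r)) - Ci * tau)) / D)%C.
        -- transitivity ((tau * D - RtoC 2 * Ci) / D)%C; [now field|f_equal].
           unfold D; rewrite !RtoC_minus, !RtoC_plus; ring [Hi HdC].
        -- rewrite <- E1, <- E2; now field.
    + intros [-> ->]; split; apply Cminus_0_eq.
      * transitivity ((RtoC 2 * Ci - RtoC a * (D + (RtoC (b + c) + Ci * RtoC (d - a)))
          - RtoC b * Ci * (D - (RtoC (b + c) + Ci * RtoC (d - a)))) / D)%C; [now field|].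
        transitivity (RtoC 0 / D)%C; [f_equal|now field].
        unfold D; rewrite !RtoC_minus, !RtoC_plus; ring [Hi HdC].
      * transitivity ((RtoC 2 * Ci * Ci
          - RtoC c * (D + (RtoC (b + c) + Ci * RtoC (d - a)))
          - RtoC d * Ci * (D - (RtoC (b + c) + Ci * RtoC (d - a)))) / D)%C; [now field|].
        transitivity (RtoC 0 / D)%C; [f_equal|now field].
        unfold D; rewrite !RtoC_minus, !RtoC_plus; ring [Hi HdC].
  - assert (HN : Cmod D ^ 2 = 4 + ((a - d) ^ 2 + (b + c) ^ 2)).
    { unfold Cmod; rewrite pow2_sqrt.
      - unfold D; simpl; nra.
      - apply Rplus_le_le_0_compat; apply pow2_ge_0. }
    rewrite <- HN, Cmod_div by exact HD.
    assert (Cmod D <> 0) by (intro E; apply HD; now apply Cmod_eq_0).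
    assert (H2i : Cmod (RtoC 2 * Ci)%C = 2).
    { rewrite Cmod_mult, Cmod_R, Rabs_right by lra.
      unfold Cmod, Ci; simpl.
      replace (0 * (0 * 1) + 1 * (1 * 1)) with 1 by ring; rewrite sqrt_1; ring. }
    rewrite H2i; now field.
Qed.

(** The transfer matrix of the chain is [u V - w R^(-1)] with [u = U_(N-1)] and
    [w = U_(N-2)]; the unimodular formula for the intensity sees only [u V]. *)
Lemma scattering_system_regular (N : nat) (th1 th2 th3 phi psi : R) :
  (1 <= N)%nat -> 0 < th1 -> 0 < th2 -> 0 < th3 -> cos phi <> 0 ->
  exists r0 tau0 : C,
    (forall r tau,
      (exists y z a,
        scattering_system N th1 th2 th3 (cos psi) (sin psi) phi r tau y z a) <->
      r = r0 /\ tau = tau0) /\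
    Cmod tau0 ^ 2 = profile N (coef_A th1 th2) (coef_B th1 th2 th3) phi psi.
Proof.
  intros HN H1 H2 H3 Hphi.
  set (A := coef_A th1 th2); set (B := coef_B th1 th2 th3).
  set (q := th2 / th1); set (p := 2 * B * tan phi).
  set (xi := A * cos psi - B * tan phi * sin psi).
  destruct N as [|n]; [lia|clear HN].
  set (u := shifted_U (S n) xi); set (w := shifted_U n xi).
  set (c := cos psi); set (s := sin psi).
  assert (Hq : q <> 0) by (apply Rgt_not_eq, Rdiv_lt_0_compat; assumption).
  assert (Hcs : s * s + c * c = 1) by exact (sin2_cos2 psi).
  assert (HA : 2 * A = q + / q) by (unfold A, q, coef_A; field; lra).
  assert (Hxi : 2 * xi = q * c + / q * c - p * s).
  { unfold p; replace (q * c + / q * c) with ((q + / q) * c) by ring.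
    rewrite <- HA; unfold xi; fold c s; ring. }
  pose proof (shifted_U_det n xi) as Hdet; fold u w in Hdet.
  rewrite (Rmult_assoc (2 * xi)) in Hdet.
  rewrite Hxi in Hdet.
  destruct (unimodular_scattering (u * q - w * c) (w * s)
              (- (u * p) - w * s) (u * / q - w * c)) as (r0 & tau0 & HS & HT).
  { rewrite <- Hdet.
    transitivity (u ^ 2 * (q * / q) - u * w * (q * c + / q * c - p * s)
                  + w ^ 2 * (s * s + c * c)); [ring|].
    rewrite Hcs, Rinv_r by exact Hq; ring. }
  exists r0, tau0; split.
  - intros r tau; rewrite <- (HS r tau).
    set (y0 := ((1 + r) * RtoC c - Ci * (1 - r) * RtoC s)%C).
    set (z0 := ((1 + r) * RtoC s + Ci * (1 - r) * RtoC c)%C).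
    assert (Hs : (RtoC s * RtoC s)%C = (RtoC 1 - RtoC c * RtoC c)%C)
      by (rewrite <- !RtoC_mult, <- RtoC_minus; f_equal; lra).
    assert (EY : (y0 * RtoC c + z0 * RtoC s)%C = (1 + r)%C)
      by (unfold y0, z0; ring [Hs]).
    assert (EZ : (z0 * RtoC c - y0 * RtoC s)%C = (Ci * (1 - r))%C)
      by (unfold y0, z0; ring [Hs]).
    assert (HP : forall y z : nat -> C,
      y O = y0 -> z O = z0 ->
      (forall j, (j < S n)%nat ->
        transfer_relation q p c s (y j) (z j) (y (S j)) (z (S j))) ->
      y (S n) = (RtoC (u * q - w * c) * (1 + r) + RtoC (w * s) * (Ci * (1 - r)))%C /\
      z (S n) = (RtoC (- (u * p) - w * s) * (1 + r)
                 + RtoC (u * / q - w * c) * (Ci * (1 - r)))%C).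
    { intros y z Ey Ez Ht.
      destruct (transfer_power q p c s xi (S n) n y z Hq Hcs Hxi Ht (le_n _))
        as [E1 E2].
      rewrite Ey, Ez, EY in E1; rewrite Ey, Ez, EY, EZ in E2; fold u w in E1, E2.
      rewrite E1, E2; unfold y0, z0.
      rewrite !RtoC_minus, RtoC_opp, !RtoC_mult; split; ring. }
    split.
    + intros (y & z & a & E1 & E2 & E3 & E4 & HV).
      destruct (HP y z E1 E2) as [E5 E6].
      { intros j Hj; apply (vertex_relation_transfer th1 th2 th3 c s phi); try assumption.
        exists (a j); now apply HV. }
      rewrite <- E4, <- E5, <- E6, E3; split; reflexivity.
    + intros [E1 E2].
      set (st := fun j => Nat.iter j (fun v : C * C =>
        ((RtoC q * (fst v * RtoC c + snd v * RtoC s))%C,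
         (RtoC (/ q) * (snd v * RtoC c - fst v * RtoC s)
          - RtoC p * (fst v * RtoC c + snd v * RtoC s))%C)) (y0, z0)).
      assert (Ht : forall j, transfer_relation q p c s (fst (st j)) (snd (st j))
                 (fst (st (S j))) (snd (st (S j)))) by (intro j; split; reflexivity).
      destruct (HP (fun j => fst (st j)) (fun j => snd (st j)) eq_refl eq_refl)
        as [E5 E6]; [intros j _; apply Ht|].
      destruct (finite_choice (fun j a => vertex_relation th1 th2 th3 c s phi
        (fst (st j)) (snd (st j)) (fst (st (S j))) (snd (st (S j))) a) (S n))
        as [a Ha].
      { intros j _; now apply vertex_relation_transfer; try apply Ht. }
      exists (fun j => fst (st j)), (fun j => snd (st j)), a.
      split; [reflexivity|split; [reflexivity|]].
      split; [now rewrite E5, E1|split; [now rewrite E6, E2|]].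
      intros j Hj; apply Ha; lia.
  - rewrite HT; unfold profile.
    replace (S n - 1)%nat with n by lia.
    fold xi; change (chebyshev_U n xi) with u.
    replace (u * q - w * c - (u * / q - w * c)) with (u * (q - / q)) by ring.
    replace (w * s + (- (u * p) - w * s)) with (- (u * p)) by ring.
    assert (HQ : (u * (q - / q)) ^ 2 = u ^ 2 * (4 * (A ^ 2 - 1))).
    { replace (4 * (A ^ 2 - 1)) with ((2 * A) ^ 2 - 4 * (q * / q))
        by (rewrite Rinv_r by exact Hq; ring).
      rewrite HA; ring. }
    rewrite HQ; unfold p, tan.
    assert (HA1 : 1 <= A) by now apply coef_A_ge_1.
    pose proof (profile_denominator_pos A B phi u HA1 Hphi) as HDen.
    set (E := 4 + _).
    assert (HE : E * cos phi ^ 2 = 4 * (cos phi ^ 2 +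
      ((A ^ 2 - 1) * cos phi ^ 2 + B ^ 2 * sin phi ^ 2) * u ^ 2))
      by (unfold E; now field).
    assert (E <> 0) by (intro H0; rewrite H0 in HE; lra).
    apply Rmult_eq_reg_r with E; [|assumption].
    field_simplify_eq; [|split; lra || assumption].
    nra.
Qed.

(** A resonator with [cos phi = 0] forces a zero of the field at its vertex.  At
    [v_1] this means [1 + r = 0], at [v_N] it means [tau = 0].  Conversely the
    mode of the first resonator can balance the derivative of the standing wave
    on the incoming lead, everything beyond being zero. *)
Lemma scattering_system_blocked (N : nat) (th1 th2 th3 phi psi : R) (r tau : C) :
  (1 <= N)%nat -> 0 < th1 -> 0 < th2 -> 0 < th3 -> cos phi = 0 ->
  (exists y z a,
     scattering_system N th1 th2 th3 (cos psi) (sin psi) phi r tau y z a) <->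
  r = (- 1)%C /\ tau = RtoC 0.
Proof.
  intros HN H1 H2 H3 Hphi.
  set (c := cos psi); set (s := sin psi).
  assert (N1 : RtoC th1 <> RtoC 0) by (apply RtoC_neq_0; lra).
  assert (N2 : RtoC th2 <> RtoC 0) by (apply RtoC_neq_0; lra).
  assert (N3 : RtoC th3 <> RtoC 0) by (apply RtoC_neq_0; lra).
  assert (Ns : RtoC (sin phi) <> RtoC 0).
  { apply RtoC_neq_0; intro E; pose proof (sin2_cos2 phi) as E1.
    unfold Rsqr in E1; rewrite E, Hphi in E1; lra. }
  assert (Hs : (RtoC s * RtoC s)%C = (RtoC 1 - RtoC c * RtoC c)%C).
  { pose proof (sin2_cos2 psi) as E; unfold Rsqr in E; fold c s in E.
    rewrite <- !RtoC_mult, <- RtoC_minus; f_equal; lra. }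
  unfold scattering_system, vertex_relation; rewrite Hphi; split.
  - intros (y & z & a & E1 & E2 & E3 & E4 & HV).
    assert (Hy : forall j, (j < N)%nat ->
      (y j * RtoC c + z j * RtoC s)%C = RtoC 0 /\ y (S j) = RtoC 0).
    { intros j Hj; destruct (HV j Hj) as (V1 & V2 & _).
      assert (Ey : y (S j) = RtoC 0).
      { transitivity (RtoC th2 * (y (S j) / RtoC th2))%C; [now field|].
        rewrite V2; now field. }
      split; [|exact Ey].
      transitivity (RtoC th1 * ((y j * RtoC c + z j * RtoC s) / RtoC th1))%C;
        [now field|].
      rewrite V1, Ey; now field. }
    split.
    + destruct (Hy O HN) as [E _]; rewrite E1, E2 in E.
      assert (Er : (1 + r)%C = RtoC 0) by (rewrite <- E; ring [Hs]).
      transitivity ((1 + r) - 1)%C; [ring|rewrite Er; ring].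
    + destruct N as [|n]; [lia|].
      rewrite <- E3; apply Hy; lia.
  - intros [-> ->].
    (* With [r = - 1] the lead carries [2 i sin (k x)]; the data at [- h] are
       [2 i] times those of this sine. *)
    exists (fun j => match j with O => (- (RtoC 2 * Ci * RtoC s))%C | _ => RtoC 0 end),
      (fun j => match j with O => (RtoC 2 * Ci * RtoC c)%C | _ => RtoC 0 end),
      (fun j => match j with
                | O => (RtoC 2 * Ci * RtoC th1 / (RtoC th3 * RtoC (sin phi)))%C
                | _ => RtoC 0 end).
    split; [ring|split; [ring|]].
    split; [destruct N; [lia|reflexivity]|split; [destruct N; [lia|ring]|]].
    intros [|j] _.
    + split; [now field|split; [now field|]].
      transitivity (RtoC th1 * (RtoC 2 * Ci) * (RtoC s * RtoC s + RtoC c * RtoC c))%C;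
        [rewrite Hs; now field|ring].
    + split; [now field|split; [now field|ring]].
Qed.

(** * The transmission probability *)

Lemma Cmod_expi (x : R) : Cmod (expi x) = 1.
Proof.
  unfold Cmod, expi; simpl.
  replace (cos x * (cos x * 1) + sin x * (sin x * 1))
    with ((sin x)² + (cos x)²) by (unfold Rsqr; ring).
  rewrite sin2_cos2; apply sqrt_1.
Qed.

Lemma expi_opp (x : R) : (expi (- x) * expi x)%C = RtoC 1.
Proof.
  pose proof (sin2_cos2 x) as E; unfold Rsqr in E.
  unfold expi; rewrite cos_neg, sin_neg.
  apply injective_projections; simpl; [rewrite <- E|]; ring.
Qed.

(** The data at [v_N] involve [tau = t exp (i k x_N)] rather than [t]; the two
    differ by a phase. *)
Lemma is_transmission_probability_of_system (N : nat)
    (h l th1 th2 th3 al be k : R) (r0 tau0 : C) :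
  (1 <= N)%nat -> 0 < h -> 0 < l -> (al, be) <> (0, 0) -> 0 < k ->
  (forall r tau,
     (exists y z a, scattering_system N th1 th2 th3 (cos (k * h)) (sin (k * h))
        (resonator_phase l al be k) r tau y z a) <-> r = r0 /\ tau = tau0) ->
  is_transmission_probability N h l th1 th2 th3 al be k (Cmod tau0 ^ 2).
Proof.
  intros HN Hh Hl Hab Hk Hsys.
  set (x := k * vertex_pos h N).
  assert (Hsol : forall r t,
    (exists f, scattering_solution N h l th1 th2 th3 al be k r t f) <->
    r = r0 /\ (t * expi x)%C = tau0).
  { intros r t; rewrite <- Hsys; now apply scattering_solution_iff. }
  exists r0, (tau0 * expi (- x))%C; split; [|split].
  - apply Hsol; split; [reflexivity|].
    rewrite <- Cmult_assoc, expi_opp; ring.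
  - intros r' t' f Hf.
    destruct (proj1 (Hsol r' t') (ex_intro _ f Hf)) as [-> <-].
    split; [reflexivity|].
    rewrite <- Cmult_assoc, (Cmult_comm (expi x)), expi_opp; ring.
  - now rewrite Cmod_mult, Cmod_expi, Rmult_1_r.
Qed.

Lemma transmission_probability_profile_ext (N : nat)
    (h l th1 th2 th3 al be k : R) :
  (1 <= N)%nat -> 0 < h -> 0 < l -> 0 < th1 -> 0 < th2 -> 0 < th3 ->
  (al, be) <> (0, 0) -> 0 < k ->
  is_transmission_probability N h l th1 th2 th3 al be k
    (profile_ext N (coef_A th1 th2) (coef_B th1 th2 th3)
       (resonator_phase l al be k) (k * h)).
Proof.
  intros HN Hh Hl H1 H2 H3 Hab Hk; unfold profile_ext.
  destruct (Req_EM_T _ 0) as [Hc|Hc].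
  - replace 0 with (Cmod (RtoC 0) ^ 2) by (rewrite Cmod_0; ring).
    apply (is_transmission_probability_of_system N h l th1 th2 th3 al be k
             (- 1)%C); try assumption.
    intros r tau; now apply scattering_system_blocked.
  - destruct (scattering_system_regular N th1 th2 th3
      (resonator_phase l al be k) (k * h)) as (r0 & tau0 & HS & HT); try assumption.
    rewrite <- HT.
    now apply (is_transmission_probability_of_system N h l th1 th2 th3 al be k r0).
Qed.

Theorem proposition2 (N : nat) (h l th1 th2 th3 al be : R)
  (hN : (1 <= N)%nat) (hh : 0 < h) (hl : 0 < l)
  (hth1 : 0 < th1) (hth2 : 0 < th2) (hth3 : 0 < th3)
  (hab : (al, be) <> (0, 0)) :
  let A := coef_A th1 th2 in
  let B := coef_B th1 th2 th3 in
  let F := profile N A B in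
  let Fext := profile_ext N A B in
  (* (a) periodicity, range, smoothness *)
  ((forall phi psi, cos phi <> 0 -> F (phi + PI) psi = F phi psi) /\
   (forall phi psi, cos phi <> 0 -> F phi (psi + PI) = F phi psi) /\
   (forall phi psi, cos phi <> 0 -> 0 <= F phi psi <= 1) /\
   (forall phi psi, (forall n : Z, phi <> PI * IZR n - PI / 2) ->
      forall m : nat, ex_diff_n F m phi psi)) /\
  (* (b) continuity of the extension *)
  (forall phi psi, ~ lattice phi psi -> continuity_2d_pt Fext phi psi) /\
  (* (c) the transmission probability *)
  (forall k : R, 0 < k ->
     ~ lattice (resonator_phase l al be k) (k * h) ->
     is_transmission_probability N h l th1 th2 th3 al be k
       (Fext (resonator_phase l al be k) (k * h))).
Proof.
  intros A B F Fext.
  assert (HA : 1 <= A) by now apply coef_A_ge_1.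
  assert (HB : 0 < B) by now apply coef_B_pos.
  split; [|split].
  - split; [|split; [|split]].
    + intros phi psi _; apply profile_periodic_phi.
    + intros phi psi _; apply profile_periodic_psi.
    + intros phi psi Hc; now apply profile_bounds.
    + intros phi psi Hphi m.
      apply trig_rational_ex_diff_n; [now apply trig_rational_profile|].
      intro Hc; destruct (cos_eq_0_0 _ Hc) as [n Hn].
      apply (Hphi (n + 1)%Z); rewrite plus_IZR; lra.
  - intros phi psi HL; now apply profile_ext_continuous.
  - intros k Hk _; now apply transmission_probability_profile_ext.
Qed.
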